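(* Let $K\ge 2$, let $\mathcal{X}_1,\dots,\mathcal{X}_K$ be Euclidean vector spaces, and let $X=(X_1,\dots,X_K)$ be a random vector with values in $\mathcal{X}=\mathcal{X}_1\times\cdots\times\mathcal{X}_K$ and distribution $\mathbb{P}_X$. Assume that for all $k\in\{1,\dots,K\}$ one has $\mathbb{E}(X_k)=0$, $\mathbb{E}(\Vert X_k\Vert_k^2)<+\infty$ and $V_k=I_k$ (the identity operator of $\mathcal{X}_k$). Then, for any vector $x=(x_1,\dots,x_K)\in\mathcal{X}$, the influence function $\mathrm{IF}(x;T,\mathbb{P}_X)$ of the functional $\mathbb{T}$ at $\mathbb{P}_X$ is $$\mathrm{IF}(x;T,\mathbb{P}_X)=\sum_{k=1}^K\sum_{\substack{\ell=1\\ \ell\ne k}}^K\Big\{-\tfrac12\,\tau_k^*(x_k\otimes x_k)V_{k\ell}\tau_\ell-\tfrac12\,\tau_\ell^*V_{\ell k}(x_k\otimes x_k)\tau_k+\tau_k^*(x_\ell\otimes x_k)\tau_\ell\Big\}.$$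
   Context: Euclidean vector spaces are finite-dimensional real inner product spaces; $\langle\cdot,\cdot\rangle_k$, $\Vert\cdot\Vert_k$ are the inner product and norm of $\mathcal{X}_k$, and $\mathcal{X}$ carries $\langle\alpha,\beta\rangle_{\mathcal{X}}=\sum_k\langle\alpha_k,\beta_k\rangle_k$. The tensor product $x\otimes y$ is the linear map $h\mapsto\langle x,h\rangle y$; $A^*$ is the adjoint of $A$. $\tau_k:\mathcal{X}\to\mathcal{X}_k$, $\alpha\mapsto\alpha_k$, is the canonical projection, with adjoint $\tau_k^*:t\mapsto(0,\dots,0,t,0,\dots,0)$ ($t$ in position $k$). $V_{k\ell}=\mathbb{E}(X_\ell\otimes X_k)$, $V_k=V_{kk}$. $\mathcal{L}(\mathcal{X})$ is the space of linear maps from $\mathcal{X}$ to itself, and $f,g:\mathcal{L}(\mathcal{X})\to\mathcal{L}(\mathcal{X})$ are $$f(A)=\sum_{k=1}^K\tau_k^*\tau_kA\tau_k^*\tau_k,\qquad g(A)=\sum_{k=1}^K\sum_{\ell\ne k}\tau_k^*\tau_kA\tau_\ell^*\tau_\ell .$$ For a probability measure $\mathbb{P}$ on $\mathcal{X}$ let $\mathbb{V}(\mathbb{P})=\int x\otimes x\,d\mathbb{P}(x)-\big(\int x\,d\mathbb{P}(x)\big)\otimes\big(\int x\,d\mathbb{P}(x)\big)$ and $\mathbb{T}(\mathbb{P})=f(\mathbb{V}(\mathbb{P}))^{-1/2}g(\mathbb{V}(\mathbb{P}))f(\mathbb{V}(\mathbb{P}))^{-1/2}$; $T=\mathbb{T}(\mathbb{P}_X)$.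 The influence function of a functional $S$ at $\mathbb{P}$ is $\mathrm{IF}(x;S,\mathbb{P})=\lim_{\varepsilon\downarrow0}\varepsilon^{-1}\big(S((1-\varepsilon)\mathbb{P}+\varepsilon\delta_x)-S(\mathbb{P})\big)$, with $\delta_x$ the Dirac measure at $x$; $\mathrm{IF}(x;T,\mathbb{P}_X)$ means $\mathrm{IF}(x;\mathbb{T},\mathbb{P}_X)$. *)

(* Defs.v *)
From HB Require Import structures.
From mathcomp Require Import all_boot all_order all_algebra.
From mathcomp Require Import sesquilinear.
From mathcomp Require Import all_classical all_reals all_analysis.
Set Implicit Arguments.
Unset Strict Implicit.
Unset Printing Implicit Defensive.
Import Order.TTheory GRing.Theory Num.Theory.
Import numFieldNormedType.Exports.
Local Open Scope classical_set_scope.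
Local Open Scope ring_scope.

HB.mixin Record Vector_isEuclidean (R : realType) V & Vector R V := {
  dotp : {dot V for idfun}
}.

#[short(type="euclideanType")]
HB.structure Definition Euclidean (R : realType) :=
  { V of Vector R V & Vector_isEuclidean R V }.

Section euclidean_theory.
Context {R : realType} {V : euclideanType R}.
Implicit Types x y z : V.

Lemma dotpC x y : dotp x y = dotp y x.
Proof. by rewrite hermC expr0 mul1r. Qed.

Lemma dotpDl x y z : dotp (x + y) z = dotp x z + dotp y z.
Proof. exact: linearDl. Qed.

Lemma dotpZl (a : R) x y : dotp (a *: x) y = a * dotp x y.
Proof. by rewrite linearZl_LR. Qed.

Lemma dotp0l y : dotp (0 : V) y = 0.
Proof. by rewrite -(scale0r y) dotpZl mul0r. Qed.

Lemma dotp_gt0 x : x != 0 -> 0 < dotp x x.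
Proof. exact: neq0_dnorm_gt0. Qed.

Lemma dotp_ge0 x : 0 <= dotp x x.
Proof. by have [->|/dotp_gt0/ltW //] := eqVneq x 0; rewrite dotp0l. Qed.

Definition enorm x : R := Num.sqrt (dotp x x).

Definition eopen : set (set V) :=
  [set A | forall x, A x ->
     exists2 e : R, 0 < e & forall y, enorm (y - x) < e -> A y].

End euclidean_theory.

(* [g_sigma_algebraType] wants a pointed type; the point is 0. *)
Definition pointed_euclidean (R : realType) (V : euclideanType R) : Type := V.
HB.instance Definition _ (R : realType) (V : euclideanType R) :=
  Choice.on (pointed_euclidean V).
HB.instance Definition _ (R : realType) (V : euclideanType R) :=
  isPointed.Build (pointed_euclidean V) (0 : V).

Definition borel (R : realType) (V : euclideanType R) :=
  @g_sigma_algebraType (pointed_euclidean V) (@eopen R V).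
HB.instance Definition _ (R : realType) (V : euclideanType R) :=
  Measurable.on (borel V).

Section product.
Import VectorInternalTheory.
Context {R : realType} {K : nat} (E : 'I_K -> euclideanType R).

Definition eprod : Type := {dffun forall k : 'I_K, E k}.

HB.instance Definition _ := Choice.on eprod.

Implicit Types a b c : eprod.

Definition eprod_of (h : forall k, E k) : eprod := finfun h.

Lemma eprod_ofE h k : eprod_of h k = h k.
Proof. exact: ffunE. Qed.

Lemma eprodP a b : (forall k, a k = b k) <-> a = b.
Proof. exact: ffunP. Qed.

Let add a b : eprod := eprod_of (fun k => a k + b k).
Let opp a : eprod := eprod_of (fun k => - a k).
Let zero : eprod := eprod_of (fun k => 0).
Let scale (r : R) a : eprod := eprod_of (fun k => r *: a k).

Let addA : associative add.
Proof. by move=> a b c; apply/eprodP => k; rewrite !eprod_ofE addrA. Qed.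
Let addC : commutative add.
Proof. by move=> a b; apply/eprodP => k; rewrite !eprod_ofE addrC. Qed.
Let add0 : left_id zero add.
Proof. by move=> a; apply/eprodP => k; rewrite !eprod_ofE add0r. Qed.
Let addN : left_inverse zero opp add.
Proof. by move=> a; apply/eprodP => k; rewrite !eprod_ofE addNr. Qed.

HB.instance Definition _ := GRing.isZmodule.Build eprod addA addC add0 addN.

Let scaleA r s a : scale r (scale s a) = scale (r * s) a.
Proof. by apply/eprodP => k; rewrite !eprod_ofE scalerA. Qed.
Let scale1 : left_id 1 scale.
Proof. by move=> a; apply/eprodP => k; rewrite !eprod_ofE scale1r. Qed.
Let scaleDr : right_distributive scale +%R.
Proof. by move=> r a b; apply/eprodP => k; rewrite !eprod_ofE scalerDr. Qed.
Let scaleDl a : {morph scale^~ a : r s / r + s}.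
Proof. by move=> r s; apply/eprodP => k; rewrite !eprod_ofE scalerDl. Qed.

HB.instance Definition _ :=
  GRing.Zmodule_isLmodule.Build R eprod scaleA scale1 scaleDr scaleDl.

Lemma eprodDE a b k : (a + b) k = a k + b k.
Proof. exact: eprod_ofE. Qed.
Lemma eprodZE (r : R) a k : (r *: a) k = r *: a k.
Proof. exact: eprod_ofE. Qed.

Let vect : Vector.axiom (\sum_k dim (E k)) eprod.
Proof.
exists (fun a => \mxrow_k v2r (a k)) => [r a b|].
  by apply/matrixP => i j; rewrite !mxE eprodDE eprodZE linearP !mxE.
exists (fun v => eprod_of (fun k => r2v (submxrow v k))) => [a|v].
  by apply/eprodP => k; rewrite eprod_ofE mxrowK v2rK.
by apply/mxrowP => k; rewrite mxrowK eprod_ofE r2vK.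
Qed.

HB.instance Definition _ := Lmodule_hasFinDim.Build R eprod vect.

Definition eprod_dotp a b : R := \sum_k dotp (a k) (b k).

Let dotp_bilinear : bilinear_for *%R (idfun \; *%R) eprod_dotp.
Proof.
have lin a r b c :
    eprod_dotp (r *: b + c) a = r * eprod_dotp b a + eprod_dotp c a.
  rewrite /eprod_dotp mulr_sumr -big_split/=; apply: eq_bigr => k _.
  by rewrite eprodDE eprodZE dotpDl dotpZl.
have sym a b : eprod_dotp a b = eprod_dotp b a.
  by apply: eq_bigr => k _; rewrite dotpC.
by split => [a r b c|a r b c] /=; rewrite ?lin// sym lin !(sym _ a).
Qed.

HB.instance Definition _ :=
  bilinear_isBilinear.Build R eprod eprod R *%R (idfun \; *%R)
    eprod_dotp dotp_bilinear.

Let dotp_hermitian a b : eprod_dotp a b = (-1) ^+ false * idfun (eprod_dotp b a).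
Proof.
by rewrite expr0 mul1r; apply: eq_bigr => k _; rewrite dotpC.
Qed.

HB.instance Definition _ :=
  isHermitianSesquilinear.Build R eprod false idfun eprod_dotp dotp_hermitian.

Let dotp_pos a : a != 0 -> 0 < eprod_dotp a a.
Proof.
move=> a0; have /existsP[k ak] : [exists k, a k != 0].
  apply: contraNT a0 => /existsPn a0; apply/eqP/eprodP => k.
  by rewrite eprod_ofE; apply/eqP; move: (a0 k); rewrite negbK.
rewrite /eprod_dotp (bigD1 k)//= ltr_wpDr ?dotp_gt0//.
by apply: sumr_ge0 => j _; exact: dotp_ge0.
Qed.

HB.instance Definition _ := isDotProduct.Build R eprod eprod_dotp dotp_pos.

HB.instance Definition _ := Vector_isEuclidean.Build R eprod eprod_dotp.

Lemma eprod_dotpE a b : dotp a b = \sum_k dotp (a k) (b k).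
Proof. by []. Qed.

Definition tau_fun (k : 'I_K) (a : eprod) : E k := a k.

Let tau_linear k : linear (tau_fun k).
Proof. by move=> r a b; rewrite /tau_fun eprodDE eprodZE. Qed.

HB.instance Definition _ k :=
  GRing.isLinear.Build R eprod (E k) _ (tau_fun k) (tau_linear k).

Definition tau (k : 'I_K) : 'Hom(eprod, E k) := linfun (tau_fun k).

Lemma tauE k a : tau k a = a k.
Proof. by rewrite lfunE. Qed.

Definition tau_adj_fun (k : 'I_K) (t : E k) : eprod :=
  eprod_of (@eqtype.dfwith _ (fun j => E j : Type) (fun j => 0) k t).

Let tau_adj_linear k : linear (@tau_adj_fun k).
Proof.
move=> r t u; apply/eprodP => j; rewrite eprodDE eprodZE !eprod_ofE.
have [kj|kj] := eqVneq k j; last by rewrite !dfwith_out// scaler0 addr0.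
by case: _ / kj; rewrite !dfwith_in.
Qed.

HB.instance Definition _ k :=
  GRing.isLinear.Build R (E k) eprod _ (@tau_adj_fun k) (@tau_adj_linear k).

Definition tau_adj (k : 'I_K) : 'Hom(E k, eprod) := linfun (@tau_adj_fun k).

Lemma tau_adjE k (t : E k) j :
  tau_adj k t j = @eqtype.dfwith _ (fun j => E j : Type) (fun j => 0) k t j.
Proof. by rewrite lfunE/= eprod_ofE. Qed.

Lemma tau_adjP k a t : dotp (tau k a) t = dotp a (tau_adj k t).
Proof.
rewrite eprod_dotpE (bigD1 k)//= big1 => [|j jk].
  by rewrite addr0 tauE tau_adjE dfwith_in.
by rewrite tau_adjE dfwith_out 1?eq_sym// dotpC dotp0l.
Qed.

Definition diag_part (A : 'End(eprod)) : 'End(eprod) :=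
  \sum_(k < K) (tau_adj k \o tau k \o A \o tau_adj k \o tau k)%VF.

Definition offdiag_part (A : 'End(eprod)) : 'End(eprod) :=
  \sum_(k < K) \sum_(l < K | l != k)
    (tau_adj k \o tau k \o A \o tau_adj l \o tau l)%VF.

End product.

Section tensor.
Context {R : realType} {U W : euclideanType R}.

Definition tensor_fun (x : U) (y : W) (h : U) : W := dotp x h *: y.

Let tensor_linear x y : linear (tensor_fun x y).
Proof.
move=> r h h'; rewrite /tensor_fun.
by rewrite dotpC dotpDl dotpZl !(dotpC _ x) scalerDl scalerA.
Qed.

HB.instance Definition _ x y :=
  GRing.isLinear.Build R U W _ (tensor_fun x y) (tensor_linear x y).

Definition tensor (x : U) (y : W) : 'Hom(U, W) := linfun (tensor_fun x y).

Lemma tensorE x y h : tensor x y h = dotp x h *: y.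
Proof. by rewrite lfunE. Qed.

End tensor.

Section operators.
Context {R : realType} {V : euclideanType R}.
Implicit Types A B : 'End(V).

Definition psd_operator A : Prop :=
  (forall x y, dotp (A x) y = dotp x (A y)) /\ (forall x, 0 <= dotp (A x) x).

(* The square root of a positive semidefinite operator is unique; the value on
   other operators is irrelevant. *)
Definition sqrt_operator A : 'End(V) :=
  xget 0 [set B | psd_operator B /\ (B \o B)%VF = A].

(* [f^-1] on 'Hom spaces is the inverse when f is bijective, which is the case
   of the square root of a positive definite operator. *)
Definition invsqrt_operator A : 'End(V) := ((sqrt_operator A)^-1)%VF.

Definition opnorm A : R := sup [set enorm (A x) | x in [set x | enorm x <= 1]].

End operators.

(* The integral of a vector-valued function, computed coordinatewise; when all
   the coordinates are integrable it does not depend on the chosen basis. *)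
Definition vintegral d (T : measurableType d) (R : realType)
    (mu : {measure set T -> \bar R}) (V : vectType R) (f : T -> V) : V :=
  \sum_(i < \dim {:V})
    (\int[mu]_(t in setT) coord (vbasis {:V}) i (f t)) *: (vbasis {:V})`_i.

Section contamination.
Context d {T : measurableType d} {R : realType}.
Variables (P : probability T R) (x : T) (eps : R).
Local Open Scope ereal_scope.

(* (1 - eps) P + eps \d_x, set to P when eps is not in [0, 1] *)
Definition contamination (A : set T) : \bar R :=
  if (0 <= eps <= 1)%R then (1 - eps)%:E * P A + eps%:E * \d_x A else P A.

Lemma contamination_measure_add (e0 : (0 <= eps)%R) (e1 : (0 <= 1 - eps)%R) :
  contamination =
  measure_add (mscale (NngNum e1) P) (mscale (NngNum e0) \d_x).
Proof.
apply/funext => A; rewrite /contamination e0 -(subr_ge0 eps) e1/=.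
by rewrite measure_addE.
Qed.

Let cont0 : contamination set0 = 0.
Proof. by rewrite /contamination !measure0 !mule0 adde0; case: ifP. Qed.

Let cont_ge0 A : 0 <= contamination A.
Proof.
rewrite /contamination; case: ifPn => // /andP[e0 e1].
by rewrite adde_ge0// mule_ge0// lee_fin// subr_ge0.
Qed.

Let cont_sigma_additive : semi_sigma_additive contamination.
Proof.
have [/andP[e0 e1]|e01] := boolP (0 <= eps <= 1)%R.
  move: (e1); rewrite -subr_ge0 => e1'.
  rewrite (contamination_measure_add e0 e1').
  exact: measure_semi_sigma_additive.
rewrite (_ : contamination = P); first exact: measure_semi_sigma_additive.
by apply/funext => A; rewrite /contamination (negbTE e01).
Qed.

HB.instance Definition _ := isMeasure.Build _ _ _ contamination
  cont0 cont_ge0 cont_sigma_additive.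

Let cont_setT : contamination setT = 1.
Proof.
rewrite /contamination probability_setT diracT !mule1.
by case: ifP => // _; rewrite -EFinD subrK.
Qed.

HB.instance Definition _ := Measure_isProbability.Build _ _ _ contamination
  cont_setT.

End contamination.

(* The one-sided limit of the difference quotients at eps = 0 exists in operator
   norm and equals L. *)
Definition is_influence_function d (T : measurableType d) (R : realType)
    (V : euclideanType R) (x : T) (S : probability T R -> 'End(V))
    (P : probability T R) (L : 'End(V)) : Prop :=
  opnorm (eps^-1 *: (S (contamination P x eps) - S P) - L) @[eps --> 0^'+]
    --> (0 : R).

Section functionals.
Context {R : realType} {K : nat} {E : 'I_K -> euclideanType R}.

Definition covariance_operator (P : probability (borel (eprod E)) R) :
    'End(eprod E) :=
  let m : eprod E := vintegral P (fun x => x : eprod E) in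
  vintegral P (fun x => tensor (x : eprod E) (x : eprod E)) - tensor m m.

Definition T_functional (P : probability (borel (eprod E)) R) :
    'End(eprod E) :=
  let V := covariance_operator P in
  let D := invsqrt_operator (diag_part V) in
  (D \o offdiag_part V \o D)%VF.

Definition cross_moment d (Omega : measurableType d) (P : probability Omega R)
    (X : {RV P >-> borel (eprod E)}) (k l : 'I_K) : 'Hom(E l, E k) :=
  vintegral P (fun w => tensor (tau E l (X w)) (tau E k (X w))).

End functionals.

(* Main.v *)
Require Import Defs.
From HB Require Import structures.
From mathcomp Require Import all_boot all_order all_algebra.
From mathcomp Require Import sesquilinear.
From mathcomp Require Import all_classical all_reals all_analysis.
From mathcomp Require Import measurable_realfun ring lra.
Set Implicit Arguments.
Unset Strict Implicit.
Unset Printing Implicit Defensive.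
Import Order.TTheory GRing.Theory Num.Theory.
Import numFieldNormedType.Exports.
Local Open Scope classical_set_scope.
Local Open Scope ring_scope.

(** Since X is centered, the contaminated covariance is exactly
    (1 - e) (M + e x (x) x) with M = E(X (x) X), and the factor 1 - e cancels in T.
    Since V_k = I_k, the k-th diagonal block of M + e x (x) x is
    I + e x_k (x) x_k, a rank-one perturbation of the identity whose inverse
    square root is known in closed form, namely I + e a_k(e) x_k (x) x_k with
    a_k(e) -> -1/2.  Writing D for the block-diagonal operator with blocks
    a_k(e) x_k (x) x_k, the difference quotient of
    (1 + e D) (g(M) + e g(x (x) x)) (1 + e D) at 0 then has a limit that is read
    off by continuity of composition in operator norm.  The chosen square root
    is identified because a positive semidefinite root of A acts as s on every
    eigenvector of A with eigenvalue s^2 > 0, and such vectors span. *)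

(** * Euclidean norm, Cauchy-Schwarz and Riesz representation *)

Section euclidean_norm.
Context {R : realType} {V : euclideanType R}.
Implicit Types x y z : V.

Lemma dotpDr x y z : dotp x (y + z) = dotp x y + dotp x z.
Proof. by rewrite dotpC dotpDl !(dotpC _ x). Qed.

Lemma dotpZr (a : R) x y : dotp x (a *: y) = a * dotp x y.
Proof. by rewrite dotpC dotpZl (dotpC y). Qed.

Lemma dotpBl x y z : dotp (x - y) z = dotp x z - dotp y z.
Proof. by rewrite dotpDl -scaleN1r dotpZl mulN1r. Qed.

Lemma dotpBr x y z : dotp x (y - z) = dotp x y - dotp x z.
Proof. by rewrite dotpC dotpBl !(dotpC _ x). Qed.

Lemma dotp0r x : dotp x 0 = 0.
Proof. by rewrite dotpC dotp0l. Qed.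

Lemma dotp_eq0 x : (dotp x x == 0) = (x == 0).
Proof.
apply/idP/idP => [|/eqP->]; last by rewrite dotp0l.
by apply: contraTT => /dotp_gt0 /lt0r_neq0.
Qed.

Lemma dotp_suml I (r : seq I) (Q : pred I) (F : I -> V) y :
  dotp (\sum_(i <- r | Q i) F i) y = \sum_(i <- r | Q i) dotp (F i) y.
Proof.
by elim/big_rec2: _ => [|i a b _ <-]; rewrite ?dotp0l ?dotpDl.
Qed.

Lemma enorm_ge0 x : 0 <= enorm x.
Proof. exact: sqrtr_ge0. Qed.

Lemma sqr_enorm x : enorm x ^+ 2 = dotp x x.
Proof. by rewrite sqr_sqrtr// dotp_ge0. Qed.

Lemma enorm_eq0 x : (enorm x == 0) = (x == 0).
Proof. by rewrite -sqrf_eq0 sqr_enorm dotp_eq0. Qed.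

Lemma enormZ (a : R) x : enorm (a *: x) = `|a| * enorm x.
Proof.
by rewrite /enorm dotpZl dotpZr mulrA -expr2 sqrtrM ?sqr_ge0// sqrtr_sqr.
Qed.

Lemma enorm0 : enorm (0 : V) = 0.
Proof. by apply/eqP; rewrite enorm_eq0. Qed.

(** Cauchy-Schwarz: the squared norm of [dotp y y *: x - dotp x y *: y] is nonnegative and equals
    [dotp y y] times the difference of the two sides. *)
Lemma sqr_dotp_le x y : dotp x y ^+ 2 <= dotp x x * dotp y y.
Proof.
have [->|y0] := eqVneq y 0; first by rewrite !dotp0r expr0n mulr0.
have yy := dotp_gt0 y0.
have := dotp_ge0 (dotp y y *: x - dotp x y *: y).
rewrite !(dotpBl, dotpBr, dotpZl, dotpZr) (dotpC y x).
rewrite [X in 0 <= X](_ : _ =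
  dotp y y * (dotp x x * dotp y y - dotp x y ^+ 2)); last by ring.
by rewrite pmulr_rge0// subr_ge0.
Qed.

Lemma normr_dotp_le x y : `|dotp x y| <= enorm x * enorm y.
Proof.
by rewrite -sqrtr_sqr -sqrtrM ?dotp_ge0// ler_sqrt ?sqr_dotp_le// mulr_ge0// dotp_ge0.
Qed.

Lemma enormD x y : enorm (x + y) <= enorm x + enorm y.
Proof.
rewrite -(ler_pXn2r (n := 2))// ?nnegrE ?addr_ge0 ?enorm_ge0//.
rewrite sqrrD !sqr_enorm dotpDl !dotpDr (dotpC y x).
have : dotp x y <= enorm x * enorm y.
  exact: le_trans (ler_norm _) (normr_dotp_le _ _).
by rewrite mulr2n; lra.
Qed.

Lemma enorm_sum I (r : seq I) (Q : pred I) (F : I -> V) :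
  enorm (\sum_(i <- r | Q i) F i) <= \sum_(i <- r | Q i) enorm (F i).
Proof.
elim/big_rec2: _ => [|i a b _ ih]; first by rewrite enorm0.
by rewrite (le_trans (enormD _ _))// lerD2l.
Qed.

Lemma riesz (f : {scalar V}) : exists z, forall y, f y = dotp z y.
Proof.
pose e := vbasis {:V}.
pose G : 'End(V) := \sum_(i < \dim {:V}) tensor e`_i e`_i.
have GE z : G z = \sum_(i < \dim {:V}) dotp z e`_i *: e`_i.
  by rewrite sum_lfunE; apply: eq_bigr => i _; rewrite tensorE dotpC.
have efree : free e by apply: basis_free; exact: vbasisP.
have decomp y : y = \sum_(i < \dim {:V}) coord e i y *: e`_i.
  by apply: coord_vbasis; exact: memvf.
have dotg z u (i : 'I_(\dim {:V})) :
    G z = \sum_(j < \dim {:V}) u j *: e`_j -> dotp z e`_i = u i.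
  by rewrite GE => /(congr1 (coord e i)); rewrite !coord_sum_free.
(* If G z = G z', then z - z' is orthogonal to every basis vector, hence to itself. *)
have G0 : lker G == 0%VS.
  apply/lker0P => z z'; rewrite [RHS]GE => zz'.
  apply/eqP; rewrite -subr_eq0 -dotp_eq0; apply/eqP.
  rewrite {2}(decomp (z - z')) dotpC dotp_suml big1// => i _.
  rewrite dotpZl dotpC dotpBl.
  rewrite (dotg z (fun j : 'I_(\dim {:V}) => dotp z' e`_j) i zz') subrr.
  by rewrite mulr0.
exists ((G^-1)%VF (\sum_(i < \dim {:V}) f e`_i *: e`_i)) => y.
set z := (G^-1)%VF _.
have gz : G z = \sum_(i < \dim {:V}) f e`_i *: e`_i by rewrite lker0_lfunVK.
rewrite {2}(decomp y) dotpC dotp_suml {1}(decomp y) linear_sum/=.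
by apply: eq_bigr => i _; rewrite linearZ/= dotpZl dotpC (dotg _ _ _ gz).
Qed.

Lemma scalar_enorm_le (f : {scalar V}) :
  exists2 C, 0 <= C & forall y, `|f y| <= C * enorm y.
Proof.
have [z fz] := riesz f; exists (enorm z); first exact: enorm_ge0.
by move=> y; rewrite fz normr_dotp_le.
Qed.

End euclidean_norm.

(** * Operator norm *)

Section operator_norm.
Context {R : realType} {V : euclideanType R}.
Implicit Types A B : 'End(V).

(** Coordinates are scalar linear maps, hence bounded by Riesz; expanding y in the basis then bounds
    A y. This makes the supremum defining [opnorm] finite. *)
Lemma lfun_enorm_le A :
  exists2 C, 0 <= C & forall y, enorm (A y) <= C * enorm y.
Proof.
pose e := vbasis {:V}.
have /choice[C C0] : forall i, exists C, 0 <= C /\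
    forall y, `|coord e i y| <= C * enorm y.
  by move=> i; have [C C0 Cy] := scalar_enorm_le (coord e i); exists C.
exists (\sum_(i < \dim {:V}) C i * enorm (A e`_i)).
  by apply: sumr_ge0 => i _; rewrite mulr_ge0 ?enorm_ge0//; case: (C0 i).
move=> y; rewrite {1}(coord_vbasis (memvf y)) linear_sum.
apply: le_trans (enorm_sum _ _ _) _; rewrite mulr_suml; apply: ler_sum => i _.
rewrite linearZ enormZ mulrAC ler_wpM2r ?enorm_ge0//.
by case: (C0 i).
Qed.

Let opset A := [set enorm (A x) | x in [set x | enorm x <= 1]].

Let opset0 A : opset A 0.
Proof. by exists 0; rewrite /= ?linear0 enorm0// ler01. Qed.

Let opset_sup A : has_sup (opset A).
Proof.
split; first by exists 0.
have [C C0 CA] := lfun_enorm_le A; exists C => _ [x /= x1 <-].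
by rewrite (le_trans (CA _))// ler_piMr.
Qed.

Lemma opnorm_ge0 A : 0 <= opnorm A.
Proof. exact/ub_le_sup/opset0/(opset_sup A).2. Qed.

Lemma opnorm_le A M :
  0 <= M -> (forall x, enorm (A x) <= M * enorm x) -> opnorm A <= M.
Proof.
move=> M0 AM; apply: ge_sup; first by exists 0; exact: opset0.
by move=> _ [x /= x1 <-]; rewrite (le_trans (AM _))// ler_piMr.
Qed.

Lemma le_opnorm A x : enorm (A x) <= opnorm A * enorm x.
Proof.
have [->|x0] := eqVneq x 0; first by rewrite linear0 enorm0 mulr0.
have nx : 0 < enorm x by rewrite lt_def enorm_eq0 x0 enorm_ge0.
rewrite -ler_pdivrMr//; apply: ub_le_sup; first exact: (opset_sup A).2.
exists ((enorm x)^-1 *: x); rewrite /= ?linearZ/= enormZ gtr0_norm ?invr_gt0//.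
  by rewrite mulVf ?gt_eqF.
by rewrite mulrC.
Qed.

Lemma opnormD A B : opnorm (A + B) <= opnorm A + opnorm B.
Proof.
apply: opnorm_le; first by rewrite addr_ge0 ?opnorm_ge0.
move=> x; rewrite add_lfunE mulrDl (le_trans (enormD _ _))// lerD ?le_opnorm//.
Qed.

Lemma opnormZ_le a A : opnorm (a *: A) <= `|a| * opnorm A.
Proof.
apply: opnorm_le => [|x]; first by rewrite mulr_ge0 ?opnorm_ge0.
by rewrite scale_lfunE enormZ -mulrA ler_wpM2l ?le_opnorm.
Qed.

Lemma opnorm_comp A B : opnorm (A \o B)%VF <= opnorm A * opnorm B.
Proof.
apply: opnorm_le => [|x]; first by rewrite mulr_ge0 ?opnorm_ge0.
rewrite comp_lfunE (le_trans (le_opnorm _ _))// -mulrA ler_wpM2l ?le_opnorm//.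
exact: opnorm_ge0.
Qed.

Lemma opnorm0 : opnorm (0 : 'End(V)) = 0.
Proof.
apply/eqP; rewrite eq_le opnorm_ge0 andbT; apply: opnorm_le => // x.
by rewrite zero_lfunE enorm0 mul0r.
Qed.

End operator_norm.

(** * Limits in operator norm as e decreases to 0 *)

Section operator_convergence.
Context {R : realType} {V : euclideanType R}.
Implicit Types (F G : R -> 'End(V)) (A B : 'End(V)).

Definition op_cvg F A : Prop := opnorm (F e - A) @[e --> 0^'+] --> (0 : R).

Lemma op_cvg_le F A (h : R -> R) :
  (forall e, opnorm (F e - A) <= h e) -> h e @[e --> 0^'+] --> (0 : R) ->
  op_cvg F A.
Proof.
move=> Fh h0; apply: (@squeeze_cvgr _ _ _ _ (fun=> 0) h) => //; last exact: cvg_cst.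
by near=> e; rewrite opnorm_ge0 Fh.
Unshelve. all: by end_near. Qed.

Lemma op_cvg_cst A : op_cvg (fun=> A) A.
Proof. by rewrite /op_cvg subrr opnorm0; exact: cvg_cst. Qed.

Lemma op_cvgD F G A B :
  op_cvg F A -> op_cvg G B -> op_cvg (fun e => F e + G e) (A + B).
Proof.
move=> FA GB; apply: (op_cvg_le
    (h := fun e => opnorm (F e - A) + opnorm (G e - B))).
  by move=> e; rewrite opprD addrACA opnormD.
by rewrite -[X in _ --> X]addr0; exact: cvgD.
Qed.

Lemma op_cvg_sum I (r : seq I) (F : I -> R -> 'End(V)) (A : I -> 'End(V)) :
  (forall i, op_cvg (F i) (A i)) ->
  op_cvg (fun e => \sum_(i <- r) F i e) (\sum_(i <- r) A i).
Proof.
move=> FA; elim: r => [|i r ih].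
  by rewrite big_nil; under eq_fun do rewrite big_nil; exact: op_cvg_cst.
by rewrite big_cons; under eq_fun do rewrite big_cons; exact: op_cvgD.
Qed.

Lemma op_cvgZ (c : R -> R) (a : R) A : c e @[e --> 0^'+] --> a ->
  op_cvg (fun e => c e *: A) (a *: A).
Proof.
move=> ca; apply: (op_cvg_le (h := fun e => `|c e - a| * opnorm A)).
  by move=> e; rewrite -scalerBl opnormZ_le.
rewrite -[X in _ --> X](mul0r (opnorm A)); apply: cvgMl.
have : c e - a @[e --> 0^'+] --> (a - a : R).
  by apply: cvgB => //; exact: cvg_cst.
by rewrite subrr => /cvg_norm; rewrite normr0.
Qed.

Lemma op_cvg_comp F G A B :
  op_cvg F A -> op_cvg G B -> op_cvg (fun e => (F e \o G e)%VF) (A \o B)%VF.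
Proof.
move=> FA GB; apply: (op_cvg_le (h := fun e =>
  opnorm (F e - A) * opnorm (G e - B) + opnorm A * opnorm (G e - B)
  + opnorm (F e - A) * opnorm B)).
  move=> e.
  (* Every term contains a difference that tends to 0, so no separate bound on the norm of [F e] is
     required. *)
  have -> : ((F e \o G e) - (A \o B) = ((F e - A) \o (G e - B)) +
      (A \o (G e - B)) + ((F e - A) \o B))%VF.
    apply/lfunP => y.
    rewrite !(comp_lfunE, add_lfunE, opp_lfunE) subrK (linearB (F e))/=.
    by rewrite addrA subrK.
  apply: le_trans (opnormD _ _) _; apply: lerD; last exact: opnorm_comp.
  apply: le_trans (opnormD _ _) _; apply: lerD; exact: opnorm_comp.
rewrite [X in _ --> X](_ : 0 = 0 * 0 + opnorm A * 0 + 0 * opnorm B); last first.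
  by rewrite !(mul0r, mulr0) !addr0.
apply: cvgD; last exact: cvgMl.
by apply: cvgD; [exact: cvgM|exact: cvgMr].
Qed.

(** Scaling by [c e] is composition with [c e] times the identity, so this reduces to
    [op_cvg_comp]. *)
Lemma op_cvg_scale (c : R -> R) (a : R) F A : c e @[e --> 0^'+] --> a ->
  op_cvg F A -> op_cvg (fun e => c e *: F e) (a *: A).
Proof.
move=> ca FA; have := op_cvg_comp (op_cvgZ \1%VF ca) FA.
rewrite -comp_lfunZl comp_lfun1l; congr (op_cvg _ _).
by apply/funext => e; rewrite -comp_lfunZl comp_lfun1l.
Qed.

End operator_convergence.

(** * Coordinatewise integrals and linear maps *)

Section vector_integral.
Context d (T : measurableType d) (R : realType) (mu : {measure set T -> \bar R}).

Lemma integrable_lincomb I (r : seq I) (c : I -> R) (g : I -> T -> R) :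
  (forall i, mu.-integrable setT (EFin \o g i)) ->
  mu.-integrable setT (EFin \o (fun t => \sum_(i <- r) g i t * c i)) /\
  \int[mu]_(t in setT) (\sum_(i <- r) g i t * c i) =
  \sum_(i <- r) (\int[mu]_(t in setT) g i t) * c i.
Proof.
move=> gi; elim: r => [|i r [ih1 ih2]].
  rewrite (_ : (fun t => _) = cst 0); last first.
    by apply/funext => t; rewrite big_nil.
  split; first exact: integrable0.
  by rewrite big_nil Rintegral_cst// mul0r.
have gc : mu.-integrable setT (EFin \o (fun t => g i t * c i)).
  rewrite (_ : _ \o _ = (fun t => (c i)%:E * (g i t)%:E)%E).
    by apply: integrableZl => //; exact: gi.
  by apply/funext => t; rewrite /= mulrC EFinM.
rewrite (_ : (fun t => _) = (fun t => g i t * c i + \sum_(i <- r) g i t * c i)).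
  split; first exact: (@integrableD _ _ _ mu setT _ (EFin \o _) (EFin \o _)).
  by rewrite big_cons RintegralD// RintegralZr// ih2.
by apply/funext => t; rewrite big_cons.
Qed.

Definition vintegrable (V : vectType R) (f : T -> V) : Prop :=
  forall i, mu.-integrable setT (EFin \o (coord (vbasis {:V}) i \o f)).

Lemma coord_lfun (V W : vectType R) (L : 'Hom(V, W)) i y :
  coord (vbasis {:W}) i (L y) =
  \sum_j coord (vbasis {:V}) j y * coord (vbasis {:W}) i (L (vbasis {:V})`_j).
Proof.
rewrite {1}(coord_vbasis (memvf y)) !linear_sum/=.
by apply: eq_bigr => j _; rewrite !linearZ.
Qed.

(** Each coordinate of [L (f t)] is a fixed linear combination of those of [f t]. Used to pass from
    X to its components, and from the second moment operator to its blocks. *)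
Lemma vintegral_lfun (V W : vectType R) (L : 'Hom(V, W)) (f : T -> V) :
  vintegrable f -> vintegral mu (fun t => L (f t)) = L (vintegral mu f).
Proof.
move=> fi; rewrite {2}/vintegral linear_sum/=.
rewrite [LHS](_ : _ = \sum_(i < \dim {:W}) coord (vbasis {:W}) i
    (\sum_(j < \dim {:V}) L ((\int[mu]_(t in setT)
      coord (vbasis {:V}) j (f t)) *: (vbasis {:V})`_j)) *: (vbasis {:W})`_i).
  by rewrite -coord_vbasis// memvf.
apply: eq_bigr => i _; congr (_ *: _).
under eq_Rintegral do rewrite coord_lfun.
rewrite (integrable_lincomb _ _ _).2; last exact: fi.
by rewrite linear_sum/=; apply: eq_bigr => j _; rewrite !linearZ.
Qed.

End vector_integral.

(** * Integrals against image and contaminated measures *)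

Section pushforward_contamination.
Context d (T : measurableType d) (R : realType) (V : vectType R).

Lemma vintegral_distribution d' (U : measurableType d') (P : probability T R)
    (X : {RV P >-> U}) (f : U -> V) :
  (forall i, measurable_fun setT (coord (vbasis {:V}) i \o f)) ->
  vintegrable P (f \o X) ->
  vintegrable (distribution P X) f /\
  vintegral (distribution P X) f = vintegral P (f \o X).
Proof.
move=> mf fi.
have mEf i : measurable_fun setT (EFin \o (coord (vbasis {:V}) i \o f)).
  exact/measurable_EFinP/mf.
split=> [i|].
  apply: (integrable_pushforward (phi := X)) => //.
  by rewrite preimage_setT; exact: fi.
apply: eq_bigr => i _; congr (_ *: _); rewrite /Rintegral; congr fine.
rewrite (integral_pushforward (phi := X))//; [exact: mEf|exact: fi].
Qed.

Variables (Q : probability T R) (x : T) (eps : R).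
Hypothesis eps01 : 0 <= eps <= 1.

Lemma ge0_integral_contamination (h : T -> \bar R) :
  measurable_fun setT h -> (forall t, 0 <= h t)%E ->
  (\int[contamination Q x eps]_(t in setT) h t =
   (1 - eps)%:E * \int[Q]_(t in setT) h t + eps%:E * h x)%E.
Proof.
move=> mh h0; have /andP[e0 e1] := eps01.
have e1' : 0 <= 1 - eps by rewrite subr_ge0.
rewrite (eq_measure_integral
    (measure_add (mscale (NngNum e1') Q) (mscale (NngNum e0) (\d_x)))); last first.
  by move=> A mA _; rewrite /= (contamination_measure_add Q x e0 e1').
rewrite ge0_integral_measure_add// !ge0_integral_mscale//=.
by rewrite integral_dirac// diracT mul1e.
Qed.

(** The formula for nonnegative functions is applied to the positive and negative parts of g, then
    recombined. *)
Lemma Rintegral_contamination (g : T -> R) :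
  Q.-integrable setT (EFin \o g) ->
  \int[contamination Q x eps]_(t in setT) g t =
  (1 - eps) * \int[Q]_(t in setT) g t + eps * g x.
Proof.
move=> gi; have mg := measurable_int _ gi.
(* Finiteness of both integrals lets the extended-real identity be read in R. *)
have fp : (\int[Q]_(t in setT) (EFin \o g)^\+%E t \is a fin_num)%E.
  by apply: integrable_fin_num => //; exact: integrable_funepos.
have fn : (\int[Q]_(t in setT) (EFin \o g)^\-%E t \is a fin_num)%E.
  by apply: integrable_fin_num => //; exact: integrable_funeneg.
rewrite /Rintegral (integralE _ _ (EFin \o g)) (integralE Q _ (EFin \o g)).
rewrite !ge0_integral_contamination//; last 2 first.
  exact: measurable_funeneg.
  exact: measurable_funepos.
have -> : ((EFin \o g)^\+ x)%E = (Num.max (g x) 0)%:E by rewrite funeposE EFin_max.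
have -> : ((EFin \o g)^\- x)%E = (Num.max (- g x) 0)%:E by rewrite funenegE EFin_max.
rewrite -(fineK fp) -(fineK fn) -!EFinM -!EFinD/=.
have gx : g x = Num.max (g x) 0 - Num.max (- g x) 0.
  by case: (leP 0 (g x)) => gx0; case: leP; lra.
have -> : eps * g x = eps * (Num.max (g x) 0 - Num.max (- g x) 0) by rewrite -gx.
by ring.
Qed.

Lemma vintegral_contamination (f : T -> V) : vintegrable Q f ->
  vintegral (contamination Q x eps) f =
  (1 - eps) *: vintegral Q f + eps *: f x.
Proof.
move=> fi; rewrite (coord_vbasis (memvf (f x))) /vintegral.
rewrite !scaler_sumr -big_split/=; apply: eq_bigr => i _.
by rewrite (Rintegral_contamination (fi i)) !scalerA -scalerDl.
Qed.

End pushforward_contamination.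

(** * Measurability and integrability from a finite second moment *)

Section second_moment.
Context {R : realType} {V : euclideanType R}.

(** f is Lipschitz, so the preimage of an open ray is open, hence Borel. *)
Lemma measurable_scalar (f : {scalar V}) :
  measurable_fun setT (f : borel V -> R).
Proof.
have [C C0 fC] := scalar_enorm_le f.
move=> mT; apply: (measurability _ (RGenOInfty.measurableE R)) => //.
move=> _ [_ [a ->] <-]; rewrite setTI; apply: sub_sigma_algebra => /= y.
rewrite /preimage/= in_itv/= andbT => ay.
(* The constant C may be 0; C + 1 gives a legitimate divisor for the radius. *)
have C1 : 0 < C + 1 by rewrite ltr_wpDl.
exists ((f y - a) / (C + 1)); first by rewrite divr_gt0// subr_gt0.
move=> z; rewrite ltr_pdivlMr// => zy; rewrite in_itv/= andbT.
have : `|f (z - y)| < f y - a.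
  apply: le_lt_trans zy; rewrite (le_trans (fC _))// mulrC ler_wpM2l ?enorm_ge0//.
  by rewrite lerDl.
by rewrite linearB/= distrC => /(le_lt_trans (ler_norm _)); rewrite ltrD2l ltrN2.
Qed.

Context d {T : measurableType d} (P : probability T R) (Y : {RV P >-> borel V}).
Let e := vbasis {:V}.
Let c (i : 'I_(\dim {:V})) (t : T) : R := coord e i (Y t : V).

(** Reduces measurability and integrability of the tensor square to those of products of two
    coordinates. *)
Lemma tensor_coord (v : V) : tensor v v =
  \sum_i \sum_j (coord e i v * coord e j v) *: tensor e`_i e`_j.
Proof.
apply/lfunP => y; rewrite tensorE sum_lfunE.
under eq_bigr do rewrite sum_lfunE.
under eq_bigr do under eq_bigr do rewrite scale_lfunE tensorE scalerA.
rewrite {1 2}(coord_vbasis (memvf v)) dotp_suml scaler_suml; apply: eq_bigr => i _.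
rewrite scaler_sumr; apply: eq_bigr => j _.
by rewrite scalerA dotpZl mulrAC.
Qed.

Let mc i : measurable_fun setT (c i).
Proof. exact: (measurableT_comp (measurable_scalar (coord e i))). Qed.

(** The squared norm is a quadratic polynomial in the measurable coordinates of Y. Applied with A
    the identity and with A a projection [tau]. *)
Lemma measurable_sqr_enorm_lfun (W : euclideanType R) (A : 'Hom(V, W)) :
  measurable_fun setT (fun t => enorm (A (Y t)) ^+ 2).
Proof.
rewrite (_ : (fun t => _) = (fun t =>
    \sum_i \sum_j c i t * c j t * dotp (A e`_i) (A e`_j))).
  do 2 (apply: measurable_sum => ?).
  by apply: measurable_funM => //; exact: measurable_funM.
apply/funext => t; rewrite sqr_enorm.
rewrite {1 2}(coord_vbasis (memvf (Y t : V))) linear_sum/= dotp_suml.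
apply: eq_bigr => i _; rewrite dotpC dotp_suml; apply: eq_bigr => j _.
by rewrite !linearZ/= dotpZl mulrA [in RHS]dotpC.
Qed.

Hypothesis Y2 : (\int[P]_t (enorm (Y t : V) ^+ 2)%:E < +oo)%E.

Let intY2 : P.-integrable setT (EFin \o (fun t => enorm (Y t : V) ^+ 2)).
Proof.
apply/integrableP; split.
  apply/measurable_EFinP.
  have := measurable_sqr_enorm_lfun \1%VF.
  by under eq_fun do rewrite id_lfunE.
under eq_integral do rewrite /= ger0_norm ?sqr_ge0//.
exact: Y2.
Qed.

Let coord_bound : exists2 C, 0 <= C & forall i v, `|coord e i v| <= C * enorm v.
Proof.
have /choice[C C0] : forall i, exists C, 0 <= C /\
    forall y : V, `|coord e i y| <= C * enorm y.
  by move=> i; have [C C0 Cy] := scalar_enorm_le (coord e i); exists C.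
exists (\sum_i C i); first by apply: sumr_ge0 => i _; case: (C0 i).
move=> i v; have [_ Ci] := C0 i; rewrite (le_trans (Ci v))// ler_wpM2r ?enorm_ge0//.
by rewrite (bigD1 i)//= lerDl sumr_ge0// => j _; case: (C0 j).
Qed.

(** Dominated by C^2 times the squared norm of Y, with C bounding all coordinate maps at once. *)
Lemma integrable_coordM i j :
  P.-integrable setT (EFin \o (fun t => c i t * c j t)).
Proof.
have [C C0 cC] := coord_bound.
apply: (@le_integrable _ _ _ P setT measurableT _
  (fun t => (C ^+ 2)%:E * (enorm (Y t : V) ^+ 2)%:E)%E).
- by apply/measurable_EFinP; exact: measurable_funM.
- move=> t _; rewrite -EFinM lee_fin /= [leRHS]ger0_norm ?mulr_ge0 ?sqr_ge0 ?enorm_ge0//.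
  by rewrite normrM -exprMn expr2; apply: ler_pM => //; exact: cC.
- exact: (integrableZl measurableT _ intY2).
Qed.

Lemma vintegrable_tensor :
  vintegrable P (fun t => tensor (Y t : V) (Y t : V)).
Proof.
move=> k.
rewrite (_ : _ \o _ = (fun t => \sum_i (EFin \o (fun t => (\sum_j (c i t * c j t) *
   coord (vbasis {:'End(V)}) k (tensor e`_i e`_j))%R)) t)%E).
  apply: integrable_sum => // i _.
  by apply: (integrable_lincomb _ _ _).1 => j; exact: integrable_coordM.
apply/funext => t; rewrite /= tensor_coord linear_sum/= -sumEFin.
apply: eq_bigr => i _; congr (_%:E).
by rewrite linear_sum/=; apply: eq_bigr => j _; rewrite linearZ.
Qed.

Lemma vintegrable_id : vintegrable P (fun t => Y t : V).
Proof.
have [C C0 cC] := coord_bound; move=> i.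
apply: (@le_integrable _ _ _ P setT measurableT _
  (EFin \o (fun t => C * (1 + enorm (Y t : V) ^+ 2)))).
- by apply/measurable_EFinP; exact: mc.
- move=> t _; rewrite lee_fin/= [leRHS]ger0_norm; last first.
    by rewrite mulr_ge0// addr_ge0// sqr_ge0.
  rewrite (le_trans (cC _ _))// ler_wpM2l//.
  (* From (u - 1)^2 >= 0 and u >= 0 one gets u <= 1 + u^2, so the second moment also controls the
     first. *)
  by have := sqr_ge0 (enorm (Y t : V) - 1); have := enorm_ge0 (Y t : V); nra.
- rewrite (_ : _ \o _ = (fun t => C%:E * (1%:E + (enorm (Y t : V) ^+ 2)%:E))%E).
    apply: (integrableZl measurableT); apply: integrableD => //.
    exact: finite_measure_integrable_cst.
  by apply/funext => t; rewrite /= EFinM EFinD.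
Qed.

End second_moment.

Lemma measurable_coord_tensor {R : realType} {V : euclideanType R} k :
  measurable_fun setT (coord (vbasis {:'End(V)}) k \o
    (fun v : borel V => tensor (v : V) (v : V))).
Proof.
pose e := vbasis {:V}.
rewrite (_ : _ \o _ = (fun v : borel V => \sum_i \sum_j
   (coord e i (v : V) * coord e j (v : V)) *
   coord (vbasis {:'End(V)}) k (tensor e`_i e`_j))).
  do 2 (apply: measurable_sum => ?).
  by apply: measurable_funM => //; apply: measurable_funM; exact: measurable_scalar.
apply/funext => v; rewrite /= tensor_coord linear_sum/=.
apply: eq_bigr => i _.
by rewrite linear_sum/=; apply: eq_bigr => j _; rewrite linearZ.
Qed.

(** * Identification of the chosen square root *)

Section square_root.
Context {R : realType} {V : euclideanType R}.
Implicit Types A B S D : 'End(V).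

(* B acts as -s, hence negatively, on B v - s v. *)
Lemma psd_root_eigen A B (s : R) v : psd_operator B -> (B \o B)%VF = A ->
  0 < s -> A v = s ^+ 2 *: v -> B v = s *: v.
Proof.
move=> [_ B0] BA s0 Av; apply/eqP; rewrite -subr_eq0 -dotp_eq0 eq_le dotp_ge0 andbT.
set w := B v - s *: v.
have Bw : B w = - s *: w.
  rewrite /w linearB linearZ/= -comp_lfunE BA Av expr2 -scalerA -scalerBr.
  by rewrite scaleNr -scalerN opprB.
have := B0 w; rewrite Bw dotpZl mulNr oppr_ge0 pmulr_rle0//.
Qed.

(** S witnesses that a root exists, so the choice in [sqrt_operator] is a genuine psd root. It and S
    both act as s on eigenvectors with eigenvalue s^2; the last hypothesis says that such agreement
    determines an operator. *)
Lemma invsqrt_operatorE A S D : psd_operator S -> (S \o S)%VF = A ->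
  (D \o S)%VF = \1%VF ->
  (forall B, (forall (s : R) v, 0 < s -> A v = s ^+ 2 *: v -> B v = S v) ->
     B = S) ->
  invsqrt_operator A = D.
Proof.
move=> S0 SA DS spanA.
have [B0 BA] : psd_operator (sqrt_operator A) /\
    (sqrt_operator A \o sqrt_operator A)%VF = A.
  exact: (@xgetPex _ 0 [set B | psd_operator B /\ (B \o B)%VF = A] (ex_intro _ S _)).
rewrite /invsqrt_operator (spanA (sqrt_operator A)); last first.
  by move=> s v s0 Av; rewrite (psd_root_eigen B0 BA s0 Av) (psd_root_eigen S0 SA s0 Av).
have kS : lker S == 0%VS.
  apply/lker0P => u v Suv.
  by rewrite -(id_lfunE u) -DS comp_lfunE Suv -comp_lfunE DS id_lfunE.
by rewrite -[RHS](lker0_compfK kS) DS comp_lfun1l.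
Qed.

End square_root.

(** * Diagonal and off-diagonal parts in blocks *)

Section block_operators.
Context {R : realType} {K : nat} {E : 'I_K -> euclideanType R}.
Implicit Types (A B M : 'End(eprod E)) (a y : eprod E) (c : 'I_K -> R).

Lemma eprod_sumE I (r : seq I) (Q : pred I) (F : I -> eprod E) k :
  (\sum_(i <- r | Q i) F i) k = \sum_(i <- r | Q i) F i k.
Proof.
elim/big_rec2: _ => [|i u v _ <-]; last by rewrite eprodDE.
by rewrite -(scale0r (0 : eprod E)) eprodZE scale0r.
Qed.

Lemma tau_adj_id k (t : E k) : tau_adj E k t k = t.
Proof. by rewrite tau_adjE dfwith_in. Qed.

Lemma tau_adj_neq k l (t : E k) : l != k -> tau_adj E k t l = 0.
Proof. by move=> lk; rewrite tau_adjE dfwith_out// eq_sym. Qed.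

Lemma dotp_tau_adj a k (t : E k) : dotp a (tau_adj E k t) = dotp (a k) t.
Proof. by rewrite -tau_adjP tauE. Qed.

Lemma eprod_decomp y : y = \sum_k tau_adj E k (y k).
Proof.
apply/eprodP => j; rewrite eprod_sumE (bigD1 j)//= tau_adj_id big1 ?addr0//.
by move=> i ij; rewrite tau_adj_neq// eq_sym.
Qed.

Lemma lfun_eprodP A B :
  (forall k (t : E k), A (tau_adj E k t) = B (tau_adj E k t)) -> A = B.
Proof.
move=> AB; apply/lfunP => y; rewrite (eprod_decomp y) !linear_sum/=.
by apply: eq_bigr => k _; rewrite AB.
Qed.

(** The coefficients c are left free: 1 gives the diagonal part of x (x) x, [root_coef] and
    [invroot_coef] the root and its inverse, and -1/2 the limit. *)
Definition block_sum (x : eprod E) c : 'End(eprod E) :=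
  \sum_k c k *: (tau_adj E k \o tensor (x k) (x k) \o tau E k)%VF.

Lemma block_sumE x c y k : block_sum x c y k = (c k * dotp (x k) (y k)) *: x k.
Proof.
rewrite sum_lfunE eprod_sumE (bigD1 k)//= big1 ?addr0 => [|i ik].
  by rewrite scale_lfunE !comp_lfunE eprodZE tau_adj_id tensorE tauE scalerA.
by rewrite scale_lfunE !comp_lfunE eprodZE tau_adj_neq ?scaler0// eq_sym.
Qed.

Lemma diag_partE A y k : diag_part A y k = A (tau_adj E k (y k)) k.
Proof.
rewrite sum_lfunE eprod_sumE (bigD1 k)//= big1 ?addr0 => [|i ik].
  by rewrite !comp_lfunE tau_adj_id !tauE.
by rewrite !comp_lfunE tau_adj_neq// eq_sym.
Qed.

Lemma diag_partD A B : diag_part (A + B) = diag_part A + diag_part B.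
Proof.
apply/lfunP => y; apply/eprodP => k.
by rewrite add_lfunE eprodDE !diag_partE add_lfunE eprodDE.
Qed.

Lemma diag_partZ (a : R) A : diag_part (a *: A) = a *: diag_part A.
Proof.
apply/lfunP => y; apply/eprodP => k.
by rewrite scale_lfunE eprodZE !diag_partE scale_lfunE eprodZE.
Qed.

Lemma offdiag_partD A B : offdiag_part (A + B) = offdiag_part A + offdiag_part B.
Proof.
rewrite /offdiag_part -big_split/=; apply: eq_bigr => k _.
rewrite -big_split/=; apply: eq_bigr => l _.
by rewrite comp_lfunDr !comp_lfunDl.
Qed.

Lemma offdiag_partZ (a : R) A : offdiag_part (a *: A) = a *: offdiag_part A.
Proof.
rewrite /offdiag_part scaler_sumr; apply: eq_bigr => k _.
rewrite scaler_sumr; apply: eq_bigr => l _.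
by rewrite -comp_lfunZr -!comp_lfunZl.
Qed.

Lemma diag_part_tensor x : diag_part (tensor x x) = block_sum x (fun=> 1).
Proof.
apply/lfunP => y; apply/eprodP => k.
by rewrite diag_partE tensorE block_sumE eprodZE dotp_tau_adj mul1r.
Qed.

Lemma diag_part_id M : (forall k, (tau E k \o M \o tau_adj E k)%VF = \1%VF) ->
  diag_part M = \1%VF.
Proof.
move=> Mid; apply/lfunP => y; apply/eprodP => k; rewrite diag_partE id_lfunE.
have /(congr1 (fun A : 'End(E k) => A (y k))) := Mid k.
by rewrite !comp_lfunE tauE id_lfunE.
Qed.

End block_operators.

(** * The functional along the contamination, and its difference quotient *)

Section contaminated_functional.
Context {R : realType} {K : nat} {E : 'I_K -> euclideanType R}.
Variables (x : eprod E) (M : 'End(eprod E)).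
Hypothesis Mid : forall k, (tau E k \o M \o tau_adj E k)%VF = \1%VF.

Let s (e : R) k := Num.sqrt (1 + e * dotp (x k) (x k)).

(* With s = sqrt (1 + e c) and c = |x|^2, the square root of
   1 + e (x (x) x) is 1 + (s - 1) / c (x (x) x), where (s - 1) / c = e / (1 + s)
   also makes sense for x = 0; its inverse is
   1 - e / (s (1 + s)) (x (x) x). *)
Definition root_coef (e : R) k := e / (1 + s e k).
Definition invroot_coef (e : R) k := - (s e k * (1 + s e k))^-1.

(** The scalar 1 - e contributes its own square root r; explicit candidates for the root and its
    inverse are then checked block by block through [invsqrt_operatorE]. *)
Lemma invsqrt_contaminated (e : R) : 0 <= e < 1 ->
  invsqrt_operator (diag_part ((1 - e) *: (M + e *: tensor x x))) =
  (Num.sqrt (1 - e))^-1 *: (\1%VF + e *: block_sum x (invroot_coef e)).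
Proof.
move=> /andP[e0 e1].
have s2 k : s e k ^+ 2 = 1 + e * dotp (x k) (x k).
  by rewrite sqr_sqrtr// addr_ge0// mulr_ge0// dotp_ge0.
have s0 k : 0 < s e k.
  by rewrite sqrtr_gt0 ltr_pwDl// mulr_ge0// dotp_ge0.
have s10 k : 0 < 1 + s e k by rewrite addr_gt0.
have r0 : 0 < Num.sqrt (1 - e) by rewrite sqrtr_gt0 subr_gt0.
have r2 : Num.sqrt (1 - e) ^+ 2 = 1 - e by rewrite sqr_sqrtr// subr_ge0 ltW.
have s2c k : e * dotp (x k) (x k) = s e k ^+ 2 - 1 by rewrite s2 addrC addKr.
(* With c = |x_k|^2, the square of 1 + b (x_k (x) x_k) is 1 + b (2 + b c) (x_k (x) x_k); this makes
   it the required block. *)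
have root_coefE k : root_coef e k * (2 + root_coef e k * dotp (x k) (x k)) = e.
  rewrite [LHS](_ : _ = e * (2 / (1 + s e k) +
    e * dotp (x k) (x k) / (1 + s e k) ^+ 2)); last first.
    by rewrite /root_coef; field; rewrite gt_eqF.
  by rewrite s2c; field; rewrite gt_eqF.
(* This is the coefficient of x_k (x) x_k, beyond the identity, in the product of the two
   candidates; its vanishing makes them inverse. *)
have invroot_coefE k : root_coef e k + e * invroot_coef e k *
    (1 + root_coef e k * dotp (x k) (x k)) = 0.
  rewrite [LHS](_ : _ = e / (1 + s e k) * (1 - (s e k)^-1 -
    e * dotp (x k) (x k) / (s e k * (1 + s e k)))); last first.
    by rewrite /root_coef /invroot_coef; field; rewrite !gt_eqF.
  by rewrite s2c; field; rewrite !gt_eqF.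
set r := Num.sqrt _ in r0 r2 *; set A := diag_part _.
have AE y k : A y k = (r ^+ 2) *: (y k + (e * dotp (x k) (y k)) *: x k).
  rewrite /A diag_partZ diag_partD diag_partZ (diag_part_id Mid) diag_part_tensor.
  rewrite scale_lfunE add_lfunE scale_lfunE id_lfunE eprodZE eprodDE eprodZE.
  by rewrite block_sumE mul1r scalerA r2.
pose S : 'End(eprod E) := r *: (\1%VF + block_sum x (root_coef e)).
have SE y k : S y k = r *: (y k + (root_coef e k * dotp (x k) (y k)) *: x k).
  by rewrite scale_lfunE eprodZE add_lfunE eprodDE id_lfunE block_sumE.
have DE y k : ((Num.sqrt (1 - e))^-1 *: (\1%VF + e *: block_sum x (invroot_coef e))) y k =
    r^-1 *: (y k + (e * (invroot_coef e k * dotp (x k) (y k))) *: x k).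
  rewrite scale_lfunE eprodZE add_lfunE eprodDE id_lfunE scale_lfunE eprodZE.
  by rewrite block_sumE scalerA.
have SA : (S \o S)%VF = A.
  apply/lfunP => y; apply/eprodP => k; rewrite comp_lfunE AE !SE.
  set b := root_coef e k; set dy := dotp (x k) (y k); set c := dotp (x k) (x k).
  have -> : b * dotp (x k) (r *: (y k + (b * dy) *: x k)) =
      r * (b * (dy + b * dy * c)) by rewrite dotpZr dotpDr dotpZr; ring.
  rewrite -[(r * _) *: _]scalerA -scalerDr scalerA -expr2 -addrA -scalerDl.
  congr (_ *: (_ + _ *: _)).
  rewrite [LHS](_ : _ = dy * (b * (2 + b * c))); last by ring.
  by rewrite /b /c root_coefE; ring.
apply: (invsqrt_operatorE (S := S)) => //.
- split=> [y z|y].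
    rewrite !eprod_dotpE; apply: eq_bigr => k _.
    rewrite !SE !(dotpZl, dotpZr, dotpDl, dotpDr) (dotpC (y k) (x k)).
    by ring.
  rewrite eprod_dotpE; apply: sumr_ge0 => k _.
  rewrite SE dotpZl dotpDl dotpZl mulr_ge0 ?(ltW r0)// addr_ge0 ?dotp_ge0//.
  by rewrite -mulrA mulr_ge0 ?divr_ge0// ?(ltW (s10 k))// -expr2 sqr_ge0.
- apply/lfunP => y; apply/eprodP => k; rewrite comp_lfunE id_lfunE DE SE.
  set b := root_coef e k; set a := invroot_coef e k.
  set dy := dotp (x k) (y k); set c := dotp (x k) (x k).
  have -> : e * (a * dotp (x k) (r *: (y k + (b * dy) *: x k))) =
      r * (dy * (e * a * (1 + b * c))) by rewrite dotpZr dotpDr dotpZr -/dy -/c; ring.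
  rewrite -[(r * _) *: _]scalerA -scalerDr scalerA mulVf ?gt_eqF// scale1r.
  rewrite -addrA -scalerDl [X in X *: _](_ : _ = 0) ?scale0r ?addr0//.
  rewrite [LHS](_ : _ = dy * (b + e * a * (1 + b * c))); last by ring.
  by rewrite /a /b /c invroot_coefE mulr0.
- move=> B AB; apply: lfun_eprodP => k t.
  (* An eigenvector of the block 1 + e (x_k (x) x_k) with eigenvalue c^2, placed in position k, is
     an eigenvector of A with eigenvalue (r c)^2. *)
  have tau_eig (u : E k) (c : R) : 0 < c ->
      u + (e * dotp (x k) u) *: x k = c ^+ 2 *: u ->
      B (tau_adj E k u) = S (tau_adj E k u).
    move=> c0 uc; apply: (AB (r * c)); first exact: mulr_gt0.
    apply/eprodP => j; rewrite AE eprodZE; have [->|jk] := eqVneq j k.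
      by rewrite tau_adj_id uc scalerA exprMn.
    by rewrite !tau_adj_neq// dotp0r mulr0 scale0r addr0 !scaler0.
  (* Splits t along x_k and its orthogonal complement, the eigenspaces for s^2 and 1. If x_k = 0 the
     component along x_k vanishes whatever [al] is. *)
  pose al := dotp (x k) t / dotp (x k) (x k).
  have [t' -> xt'] : exists2 t', t = t' + al *: x k & dotp (x k) t' = 0.
    exists (t - al *: x k); first by rewrite subrK.
    rewrite dotpBr dotpZr /al.
    have [->|xk] := eqVneq (x k) 0; first by rewrite !dotp0l mulr0 subrr.
    by rewrite divfK ?dotp_eq0// subrr.
  rewrite !linearD !linearZ/=; congr (_ + _ *: _).
    apply: (tau_eig _ 1) => //.
    by rewrite xt' mulr0 scale0r addr0 expr1n scale1r.
  apply: (tau_eig _ (s e k)) => //.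
  by rewrite s2 scalerDl scale1r.
Qed.

Lemma T_functional_contaminated (P : probability (borel (eprod E)) R) (e : R) :
  0 <= e < 1 -> covariance_operator P = (1 - e) *: (M + e *: tensor x x) ->
  T_functional P = ((\1%VF + e *: block_sum x (invroot_coef e))
    \o (offdiag_part M + e *: offdiag_part (tensor x x))
    \o (\1%VF + e *: block_sum x (invroot_coef e)))%VF.
Proof.
move=> e01 Pe; rewrite /T_functional Pe invsqrt_contaminated//.
rewrite offdiag_partZ offdiag_partD offdiag_partZ.
set r := Num.sqrt _; set D := \1%VF + _; set Z := offdiag_part M + _.
suff rr : r^-1 * (1 - e) * r^-1 = 1.
  apply/lfunP => y; rewrite !(comp_lfunE, scale_lfunE) !linearZ/= !scalerA.
  by rewrite [_ / r]mulrC mulrA rr scale1r.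
have /andP[_ e1] := e01; have r0 : 0 < r by rewrite sqrtr_gt0 subr_gt0.
have r2 : r ^+ 2 = 1 - e by rewrite sqr_sqrtr// subr_ge0 ltW.
by rewrite -r2; field; rewrite gt_eqF.
Qed.

(** Telescoping: removing the left factor, then e H, then the right factor releases one e each time.
    No division by e remains, so the limit follows by continuity. *)
Lemma T_functional_quotient (G H D : 'End(eprod E)) (e : R) : e != 0 ->
  e^-1 *: (((\1%VF + e *: D) \o (G + e *: H) \o (\1%VF + e *: D))%VF - G) =
  ((D \o (G + e *: H) \o (\1%VF + e *: D)) + (H \o (\1%VF + e *: D))
   + (G \o D))%VF.
Proof.
move=> e0; apply: (@scalerI _ _ e e0); rewrite scalerA divff// scale1r.
apply/lfunP => y.
rewrite !(add_lfunE, opp_lfunE, comp_lfunE, scale_lfunE, id_lfunE).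
set u := y + e *: D y.
have Gu : G u = G y + e *: G (D y) by rewrite /u linearD linearZ.
set w := G u + e *: H u.
rewrite !scalerDr (addrC w) -addrA -[RHS]addrA; congr (_ + _).
apply/eqP; rewrite subr_eq /w Gu; apply/eqP.
by rewrite addrC -[RHS]addrA (addrC (G y)) -[LHS]addrA (addrC (G y)).
Qed.

Lemma invroot_coef_cvg k : invroot_coef e k @[e --> 0^'+] --> (- 2^-1 : R).
Proof.
(* Continuity of the square root at 1; the coefficient then tends to -1 / (1 * (1 + 1)). *)
have scvg : s e k @[e --> 0^'+] --> (1 : R).
  rewrite [X in _ --> X](_ : 1 = Num.sqrt (1 + 0 * dotp (x k) (x k))); last first.
    by rewrite mul0r addr0 sqrtr1.
  apply: (cvg_comp (fun e => 1 + e * dotp (x k) (x k)) Num.sqrt); last first.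
    exact: sqrt_continuous.
  apply: cvgD; first exact: cvg_cst.
  by apply: cvgMl; exact: cvg_within.
apply: cvgN; apply: cvgV; first by rewrite pnatr_eq0.
rewrite [X in _ --> X](_ : 2 = 1 * (1 + 1)); last by rewrite mul1r.
by apply: cvgM => //; apply: cvgD => //; exact: cvg_cst.
Qed.

Lemma op_cvg_quotient (G H : 'End(eprod E)) :
  op_cvg (fun e => (block_sum x (invroot_coef e) \o (G + e *: H)
      \o (\1%VF + e *: block_sum x (invroot_coef e)))
    + (H \o (\1%VF + e *: block_sum x (invroot_coef e)))
    + (G \o block_sum x (invroot_coef e)))%VF
   ((block_sum x (fun=> - 2^-1) \o G) + H + (G \o block_sum x (fun=> - 2^-1)))%VF.
Proof.
have id0 : e @[e --> 0^'+] --> (0 : R) by exact: cvg_within.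
have Dcvg : op_cvg (fun e => block_sum x (invroot_coef e))
    (block_sum x (fun=> - 2^-1)).
  by apply: op_cvg_sum => k; apply: op_cvgZ; exact: invroot_coef_cvg.
(* A convergent family multiplied by e vanishes in the limit, so each factor of the form A + e F
   reduces to A. *)
have scale0 (F : R -> 'End(eprod E)) A : op_cvg F A -> op_cvg (fun e => e *: F e) 0.
  by move=> FA; rewrite -(scale0r A); exact: op_cvg_scale.
have ecvg (F : R -> 'End(eprod E)) A B : op_cvg F B -> op_cvg (fun e => A + e *: F e) A.
  move=> FB; rewrite -[X in op_cvg _ X]addr0.
  by apply: op_cvgD; [exact: op_cvg_cst|exact: scale0 FB].
apply: op_cvgD; last by apply: op_cvg_comp => //; exact: op_cvg_cst.
apply: op_cvgD.
  rewrite -[X in op_cvg _ X]comp_lfun1r; apply: op_cvg_comp; last exact: ecvg Dcvg.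
  by apply: op_cvg_comp => //; apply: ecvg; exact: op_cvg_cst.
rewrite -[X in op_cvg _ X]comp_lfun1r; apply: op_cvg_comp; last exact: ecvg Dcvg.
exact: op_cvg_cst.
Qed.

End contaminated_functional.

(** * Block form of the limit *)

Section sandwich.
Context {R : realType} {K : nat} (E : 'I_K -> euclideanType R).

(** Packaged as a linear map in A so that [vintegral_lfun] can exchange it with the expectation; the
    cross moments thereby become blocks of M. *)
Definition block_fun (k l : 'I_K) (A : 'End(eprod E)) : 'Hom(E l, E k) :=
  (tau E k \o A \o tau_adj E l)%VF.

Let block_linear k l : linear (block_fun k l).
Proof.
move=> a A B; rewrite /block_fun comp_lfunDr comp_lfunDl.
by rewrite -comp_lfunZr -comp_lfunZl.
Qed.

HB.instance Definition _ k l :=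
  GRing.isLinear.Build R _ _ _ (block_fun k l) (@block_linear k l).

Definition block (k l : 'I_K) : 'Hom('End(eprod E), 'Hom(E l, E k)) :=
  linfun (block_fun k l).

Lemma blockE k l A : block k l A = (tau E k \o A \o tau_adj E l)%VF.
Proof. by rewrite lfunE. Qed.

Lemma block_tensor x k l : block k l (tensor x x) = tensor (x l) (x k).
Proof.
rewrite blockE; apply/lfunP => t.
by rewrite !comp_lfunE !tensorE linearZ/= tauE dotp_tau_adj.
Qed.

Lemma offdiag_part_block A : offdiag_part A =
  \sum_k \sum_(l < K | l != k) (tau_adj E k \o block k l A \o tau E l)%VF.
Proof.
by do 2 (apply: eq_bigr => ? _); rewrite blockE !comp_lfunA.
Qed.

(** Since [tau E k] kills the image of [tau_adj E i] for i != k, only row k survives;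
    [offdiag_tau_adj] is the same for column k. *)
Lemma tau_offdiag A k : (tau E k \o offdiag_part A)%VF =
  \sum_(l < K | l != k) (block k l A \o tau E l)%VF.
Proof.
rewrite offdiag_part_block; apply/lfunP => y; rewrite comp_lfunE !sum_lfunE linear_sum/=.
rewrite (bigD1 k)//= [X in _ + X]big1 ?addr0 => [|i ik].
  rewrite sum_lfunE linear_sum/=; apply: eq_bigr => l _.
  by rewrite !comp_lfunE (tauE k) tau_adj_id.
rewrite sum_lfunE linear_sum/= big1// => l _.
by rewrite !comp_lfunE (tauE k) tau_adj_neq// eq_sym.
Qed.

Lemma offdiag_tau_adj A k : (offdiag_part A \o tau_adj E k)%VF =
  \sum_(l < K | l != k) (tau_adj E l \o block l k A)%VF.
Proof.
rewrite offdiag_part_block; apply/lfunP => t; rewrite comp_lfunE !sum_lfunE.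
rewrite [RHS]big_mkcond/=; apply: eq_bigr => l _; rewrite sum_lfunE.
have [lk|lk] := eqVneq l k.
  rewrite big1// => j jl; rewrite !comp_lfunE tauE tau_adj_neq -?lk//.
  by rewrite !linear0.
rewrite (bigD1 k) 1?eq_sym//= [X in _ + X]big1 ?addr0 => [|j /andP[_ jk]].
  by rewrite !comp_lfunE tauE tau_adj_id.
by rewrite !comp_lfunE tauE tau_adj_neq// !linear0.
Qed.

(** The first summands come from the rows of [offdiag_part M], the second from its columns, and the
    third from the blocks x_l (x) x_k of x (x) x. *)
Lemma influence_expansion (M : 'End(eprod E)) (x : eprod E) :
  \sum_(k < K) \sum_(l < K | l != k)
     (- (2^-1 *: (tau_adj E k \o tensor (x k) (x k)
                    \o block k l M \o tau E l)%VF)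
      - 2^-1 *: (tau_adj E l \o block l k M
                    \o tensor (x k) (x k) \o tau E k)%VF
      + (tau_adj E k \o tensor (x l) (x k) \o tau E l)%VF) =
  ((block_sum x (fun=> - 2^-1) \o offdiag_part M) + offdiag_part (tensor x x)
    + (offdiag_part M \o block_sum x (fun=> - 2^-1)))%VF.
Proof.
rewrite addrAC (offdiag_part_block (tensor x x)).
have -> : (block_sum x (fun=> - 2^-1) \o offdiag_part M)%VF =
    \sum_(k < K) \sum_(l < K | l != k) - (2^-1 *: (tau_adj E k
      \o tensor (x k) (x k) \o block k l M \o tau E l)%VF).
  apply/lfunP => y; rewrite comp_lfunE [LHS]sum_lfunE [RHS]sum_lfunE.
  apply: eq_bigr => k _.
  rewrite scale_lfunE !comp_lfunE -[tau E k _]comp_lfunE tau_offdiag !sum_lfunE.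
  rewrite !linear_sum/=; apply: eq_bigr => l _.
  by rewrite opp_lfunE scale_lfunE !comp_lfunE scaleNr.
have -> : (offdiag_part M \o block_sum x (fun=> - 2^-1))%VF =
    \sum_(k < K) \sum_(l < K | l != k) - (2^-1 *: (tau_adj E l \o block l k M
      \o tensor (x k) (x k) \o tau E k)%VF).
  apply/lfunP => y; rewrite comp_lfunE [block_sum _ _ y]sum_lfunE.
  rewrite [RHS]sum_lfunE linear_sum/=.
  apply: eq_bigr => k _.
  rewrite scale_lfunE linearZ/= !comp_lfunE.
  rewrite -[offdiag_part M _]comp_lfunE offdiag_tau_adj !sum_lfunE.
  rewrite !linear_sum/=; apply: eq_bigr => l _.
  by rewrite opp_lfunE scale_lfunE !comp_lfunE scaleNr.
rewrite -!big_split/=; apply: eq_bigr => k _.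
rewrite -!big_split/=; apply: eq_bigr => l _.
by rewrite block_tensor.
Qed.

End sandwich.

(** * Covariance of the contaminated law and the influence function *)

Lemma covariance_contamination {R : realType} {K : nat} {E : 'I_K -> euclideanType R}
    (Q : probability (borel (eprod E)) R) (x : eprod E) (M : 'End(eprod E)) :
  vintegrable Q (fun y => y : eprod E) ->
  vintegrable Q (fun y => tensor (y : eprod E) (y : eprod E)) ->
  vintegral Q (fun y => y : eprod E) = 0 ->
  vintegral Q (fun y => tensor (y : eprod E) (y : eprod E)) = M ->
  forall e : R, 0 <= e <= 1 ->
  covariance_operator (contamination Q (x : borel (eprod E)) e) =
  (1 - e) *: (M + e *: tensor x x).
Proof.
move=> i1 i2 v1 v2 e e01; rewrite /covariance_operator.
rewrite (vintegral_contamination _ e01 i1) (vintegral_contamination _ e01 i2).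
(* The contaminated mean is e x, so x (x) x gets the coefficient e - e^2 = (1 - e) e. *)
rewrite v1 v2 scaler0 add0r; apply/lfunP => y.
rewrite !(add_lfunE, opp_lfunE, scale_lfunE, tensorE) dotpZl scalerDr.
rewrite !scalerA -addrA -scalerBl; congr (_ + _ *: _); ring.
Qed.

Theorem theorem1 (R : realType) (K : nat) (K_ge2 : (2 <= K)%N)
    (E : 'I_K -> euclideanType R)
    (d : measure_display) (Omega : measurableType d) (P : probability Omega R)
    (X : {RV P >-> borel (eprod E)})
    (X_centered : forall k, vintegral P (fun w => tau E k (X w)) = 0)
    (X_moment2 : forall k,
      (\int[P]_w (enorm (tau E k (X w)) ^+ 2)%:E < +oo)%E)
    (X_white : forall k, cross_moment X k k = \1%VF)
    (x : eprod E) :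
  is_influence_function (x : borel (eprod E)) T_functional (distribution P X)
    (\sum_(k < K) \sum_(l < K | l != k)
       (- (2^-1 *: (tau_adj E k \o tensor (x k) (x k)
                      \o cross_moment X k l \o tau E l)%VF)
        - 2^-1 *: (tau_adj E l \o cross_moment X l k
                      \o tensor (x k) (x k) \o tau E k)%VF
        + (tau_adj E k \o tensor (x l) (x k) \o tau E l)%VF)).
Proof.
(* The squared norm of X is the finite sum of those of its components. *)
have X2 : (\int[P]_w (enorm (X w : eprod E) ^+ 2)%:E < +oo)%E.
  under eq_integral do rewrite sqr_enorm eprod_dotpE -sumEFin.
  rewrite ge0_integral_sum//.
  - apply: lte_sum_pinfty => k _; apply: le_lt_trans (X_moment2 k).
    rewrite le_eqVlt; apply/orP; left; apply/eqP/eq_integral => w _.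
    by rewrite sqr_enorm tauE.
  - move=> k; apply/measurable_EFinP.
    have := measurable_sqr_enorm_lfun X (tau E k).
    by under eq_fun do rewrite sqr_enorm tauE.
  - by move=> k w _; rewrite lee_fin dotp_ge0.
have iX := vintegrable_id X2.
have iXX := vintegrable_tensor X2.
have [iQ vQ] := vintegral_distribution (f := fun y : borel (eprod E) => y : eprod E)
  (fun i => measurable_scalar (coord (vbasis {:eprod E}) i)) iX.
have [iQQ vQQ] := vintegral_distribution
  (f := fun y : borel (eprod E) => tensor (y : eprod E) (y : eprod E))
  measurable_coord_tensor iXX.
set M : 'End(eprod E) :=
  vintegral P (fun w => tensor (X w : eprod E) (X w : eprod E)) in vQQ.
have mean0 : vintegral (distribution P X) (fun y => y : eprod E) = 0.
  rewrite vQ; apply/eprodP => k.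
  rewrite -tauE -vintegral_lfun//; apply: etrans (X_centered k) _.
  by rewrite -tauE linear0.
have crossE k l : cross_moment X k l = block E k l M.
  rewrite -vintegral_lfun//; congr vintegral; apply/funext => w.
  by rewrite block_tensor !tauE.
have Mid k : (tau E k \o M \o tau_adj E k)%VF = \1%VF by rewrite -blockE -crossE.
have covE := covariance_contamination x iQ iQQ mean0 vQQ.
(* Written in contaminated form with e = 0, so that [T_functional_contaminated] applies to the law
   of X itself. *)
have covQ : covariance_operator (distribution P X) =
    (1 - 0) *: (M + 0 *: tensor x x).
  rewrite /covariance_operator mean0 vQQ subr0 scale1r scale0r addr0.
  by apply/lfunP => y; rewrite add_lfunE opp_lfunE tensorE scaler0 subr0.
have TQ : T_functional (distribution P X) = offdiag_part M.
  rewrite (T_functional_contaminated Mid _ covQ) ?lexx ?ltr01//.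
  by rewrite !scale0r !addr0 comp_lfun1l comp_lfun1r.
under eq_bigr do under eq_bigr do rewrite !crossE.
rewrite influence_expansion.
have := op_cvg_quotient x (offdiag_part M) (offdiag_part (tensor x x)).
(* For 0 < e < 1 the quotient equals the expanded expression, which suffices for a limit at 0 from
   the right. *)
apply: cvg_trans; apply: near_eq_cvg; near=> e.
have e0 : 0 < e by near: e; exact: nbhs_right_gt.
have e1 : e < 1 by near: e; exact: nbhs_right_lt.
have e01 : 0 <= e < 1 by rewrite ltW.
rewrite (T_functional_contaminated Mid e01 (covE e _)); last by rewrite !ltW.
by rewrite TQ T_functional_quotient// gt_eqF.
Unshelve. all: by end_near. Qed.
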